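(* Let $\pi$ be an interactive protocol of length $N$ for $PJP(T)$ in the alternating noise model with edit corruptions, and suppose both parties are required to output the correct output when their own round counter reaches $(1-2\rho)N$, where $\rho=1/6$. Then, under an adversarial edit-corruption rate of $\rho=1/6$ (i.e., at most $2\rho N=N/3$ edit corruptions), no such protocol outputs the correct output with probability greater than $1/2$.
   Context: Pointer jumping problem $PJP(T)$: $\mathcal{T}$ is a binary tree of depth $T$; Alice's input $X$ has exactly one edge leaving each even-depth vertex, Bob's input $Y$ exactly one edge leaving each odd-depth vertex; $X\cup Y$ defines a unique root-to-leaf path, which the parties must output. Noise model: absent noise the parties alternately send symbols from a fixed alphabet, $N$ each; each party, upon receiving a symbol, computes and sends its next symbol. An edit corruption is a deletion of a transmitted symbol followed by the insertion of one symbol, directed either to the same recipient or to the other party (a spoofed reply); the edit-corruption rate $\rho$ allows at most $2\rho N$ edit corruptions, and the parties' round counters may differ. *)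

(* Defs.v *)
From HB Require Import structures.
From mathcomp Require Import all_boot all_order all_algebra.
From mathcomp Require Import all_classical all_reals all_analysis.

Set Implicit Arguments.
Unset Strict Implicit.
Unset Printing Implicit Defensive.

Import Order.TTheory GRing.Theory Num.Theory.

Local Open Scope nat_scope.

(* A vertex of the complete binary tree of depth [T] is the sequence of
   directions leading to it from the root, so its depth is its size and the
   leaves are the vertices of size [T].  The edge [(v, c)] leaves [v] in
   direction [c]; pairs whose first component is a leaf are not edges, and
   [is_input] excludes them. *)
Definition vertex (T : nat) := {bseq T of bool}.
Definition edge (T : nat) := (vertex T * bool)%type.

Definition is_input (T : nat) (par : bool) (X : {set edge T}) : bool :=
  [forall v : vertex T,
    #|[set e in X | e.1 == v]| == (size v < T) && (odd (size v) == par)].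

Definition alice_input (T : nat) (X : {set edge T}) := is_input false X.
Definition bob_input (T : nat) (Y : {set edge T}) := is_input true Y.

(* A root-to-leaf path is given by its [T] directions. *)
Definition is_pjp_path (T : nat) (X Y : {set edge T}) (p : T.-tuple bool)
    : bool :=
  [forall i : 'I_T, ([bseq of take i (p : vertex T)], tnth p i) \in X :|: Y].

Definition party := bool.
Definition alice : party := true.
Definition bob : party := false.

(* The strategy of one party: [next w X h] is the symbol sent, and
   [output w X h] the path output, by a party with random tape [w : W] and input
   [X] that has received the symbols [h] so far, in this order.  The symbols it
   has already sent are determined by [w], [X] and [h]. *)
Record strategy (S : finType) (T : nat) (d : measure_display)
    (W : measurableType d) := Strategy {
  next : W -> {set edge T} -> seq S -> S;
  output : W -> {set edge T} -> seq S -> T.-tuple bool;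
  measurable_next : forall X h s,
    measurable ([set w | next w X h = s]%classic : set W);
  measurable_output : forall X h p,
    measurable ([set w | output w X h = p]%classic : set W) }.

(* What happens to a transmitted symbol.  [Substitute] and [Spoof] are the two
   edit corruptions: the symbol is deleted and another one is inserted, towards
   the intended recipient for [Substitute] and back towards the sender, as a
   forged reply, for [Spoof]. *)
Inductive action (S : Type) :=
  Deliver | Substitute of S | Spoof of S.
Arguments Deliver {S}.

Record event (S : Type) := Event {
  sender : party;
  symbol : S;
  act : action S }.

Section Execution.
Variable S : finType.
Implicit Types (e : event S) (l : seq (event S)).

Definition delivered e : party * S :=
  match act e with
  | Deliver => (~~ sender e, symbol e)
  | Substitute s => (~~ sender e, s)
  | Spoof s => (sender e, s)
  end.

Definition corrupted e : bool := if act e is Deliver then false else true.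
Definition corruptions l : nat := count corrupted l.

Definition view (p : party) l : seq S :=
  [seq (delivered e).2 | e <- l & (delivered e).1 == p].

Definition sent (p : party) l : nat := count (fun e => sender e == p) l.

(* The party that received the last symbol speaks next; Alice speaks first. *)
Definition turn l : party := last alice [seq (delivered e).1 | e <- l].

(* [adv l p s] is what the adversary does to the symbol [s] being sent by party
   [p] after the events [l].  It has no access to the random tapes. *)
Definition adversary := seq (event S) -> party -> S -> action S.

Variables (T : nat) (dA dB : measure_display).
Variables (WA : measurableType dA) (WB : measurableType dB).
Variables (piA : strategy S T WA) (piB : strategy S T WB).
Variables (N : nat) (adv : adversary) (X Y : {set edge T}).

Definition next_symbol (a : WA) (b : WB) l : S :=
  if turn l == alice then next piA a X (view alice l)
  else next piB b Y (view bob l).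

(* Nothing is sent any more once the speaker has already sent [N] symbols. *)
Definition step (a : WA) (b : WB) l : seq (event S) :=
  let p := turn l in
  let s := next_symbol a b l in
  if sent p l < N then rcons l (Event p s (adv l p s)) else l.

(* Every effective step sends a symbol, so [2 * N] steps reach the end. *)
Definition run (a : WA) (b : WB) : seq (event S) :=
  iter (2 * N) (step a b) [::].

(* The round counter of a party is the number of symbols it has received.  The
   outputs are produced when it equals [m], from the first [m] symbols. *)
Definition output_alice (m : nat) (a : WA) (b : WB) : option (T.-tuple bool) :=
  let h := view alice (run a b) in
  if m <= size h then Some (output piA a X (take m h)) else None.

Definition output_bob (m : nat) (a : WA) (b : WB) : option (T.-tuple bool) :=
  let h := view bob (run a b) in
  if m <= size h then Some (output piB b Y (take m h)) else None.

Definition both_correct (m : nat) (a : WA) (b : WB) : bool :=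
  oapp (is_pjp_path X Y) false (output_alice m a b)
  && oapp (is_pjp_path X Y) false (output_bob m a b).

End Execution.

(* Main.v *)
(* Bob cannot tell Alice's two inputs X and X', which differ at the root, apart.
   Write N = 3K, so that he outputs after receiving 2K symbols.  With a real
   Alice on X, the adversary hides her first symbol and lets Bob talk to a
   simulated Alice on X' for K symbols, at the cost of one corruption each; then
   X's Alice, who has received nothing, talks to him for K symbols.  With a real
   Alice on X', the adversary leaves the first K exchanges alone and then replaces
   her symbols by those of a fresh simulated Alice on X.  The symbols Bob receives
   are the same function of his tape, the tape of the X'-Alice and the tape of the
   X-Alice in both cases, although one of the last two tapes is a constant of the
   (deterministic) adversary; averaging over that constant, his output would have
   to be correct with probability above 1/2 for both inputs. *)
Require Import Defs.
From HB Require Import structures.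
From mathcomp Require Import all_boot all_order all_algebra.
From mathcomp Require Import all_classical all_reals all_analysis.
From mathcomp Require Import measurable_realfun zify lra.

Set Implicit Arguments.
Unset Strict Implicit.
Unset Printing Implicit Defensive.

Import Order.TTheory GRing.Theory Num.Theory.

(** * Measurability of maps into discrete types *)

Section FiberMeasurability.
Context (d : measure_display) (W : measurableType d).

(* For countable [C] this is measurability with respect to the discrete
   sigma-algebra; it is the form in which [strategy] provides it. *)
Definition fiber_measurable (C : Type) (f : W -> C) :=
  forall c, measurable [set w | f w = c]%classic.

Lemma fiber_measurable_cst (C : Type) (c : C) :
  fiber_measurable (fun=> c).
Proof.
move=> c'; have [->|cc'] := pselect (c = c').
  by rewrite (_ : [set w | _]%classic = setT) //; apply/seteqP; split.
by rewrite (_ : [set w | _]%classic = set0) //; apply/seteqP; split.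
Qed.

(** Splitting a fiber according to the value of [f] gives a union that is countable because [C] is.
    This is how a computation is conditioned on its history below. *)
Lemma fiber_measurable_bind (C : countType) (D : Type) (f : W -> C)
    (g : C -> W -> D) :
  fiber_measurable f -> (forall c, fiber_measurable (g c)) ->
  fiber_measurable (fun w => g (f w) w).
Proof.
move=> mf mg x.
rewrite (_ : [set w | _]%classic =
  (\bigcup_c ([set w | f w = c] `&` [set w | g c w = x]))%classic); last first.
  by apply/seteqP; split=> [w /= gw|w [c _ [/= <-]]] //; exists (f w).
apply: countable_bigcupT_measurable => [|c]; first exact: countableP.
by apply: measurableI; [exact: mf|exact: mg].
Qed.

Lemma fiber_measurable_comp (C : countType) (D : Type) (h : C -> D)
    (f : W -> C) :
  fiber_measurable f -> fiber_measurable (fun w => h (f w)).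
Proof.
move=> mf; apply: (@fiber_measurable_bind C D f (fun c _ => h c)) => // c.
exact: fiber_measurable_cst.
Qed.

End FiberMeasurability.

Lemma fiber_measurable_precomp d d' (W : measurableType d)
    (W' : measurableType d') (C : Type) (h : W' -> W) (f : W -> C) :
  measurable_fun setT h -> fiber_measurable f ->
  fiber_measurable (fun w => f (h w)).
Proof. by move=> mh mf c; have := mh measurableT _ (mf c); rewrite setTI. Qed.


(** * Averaging strict bounds over a random tape *)

Section ProbabilityIntegral.
Local Open Scope ring_scope.
Local Open Scope ereal_scope.
Context (R : realType) (d : measure_display) (W : measurableType d).
Variable P : probability W R.

(** If the positive function [f - c] had integral zero, it would vanish off a null set; as it
    vanishes nowhere, that null set would be the whole space. Strictness matters: two averages of
    exactly one half would not contradict disjointness. *)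
Lemma integral_probability_gt (c : R) (f : W -> \bar R) :
  (0 <= c)%R -> measurable_fun setT f -> (forall x, c%:E < f x) ->
  c%:E < \int[P]_x f x.
Proof.
move=> c0 mf cf.
pose g x : \bar R := f x - c%:E.
have g0 x : 0 < g x by rewrite /g sube_gt0.
have mg : measurable_fun setT g.
  by apply: emeasurable_funB => //; exact: measurable_cst.
have -> : \int[P]_x f x = \int[P]_x g x + \int[P]_x cst c%:E x.
  rewrite -ge0_integralD //.
  - by apply: eq_integral => x _; exact/esym/subeK.
  - by move=> x _; exact: ltW.
rewrite integral_cst //= probability_setT mule1.
suff : 0 < \int[P]_x g x by move=> ?; rewrite -lteBlDr // subee.
rewrite lt_neqAle integral_ge0 ?andbT => [|x _]; last exact: ltW.
apply/eqP => /esym g_int0.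
have /(ae_eq_integral_abs _ measurableT mg) [A [mA PA0 subA]] :
    \int[P]_x `|g x| = 0.
  by rewrite -g_int0; apply: eq_integral => x _; rewrite gee0_abs // ltW.
have AT : A = setT.
  apply/seteqP; split=> // x _; apply: subA => /= /(_ Logic.I) gx0.
  by have := g0 x; rewrite gx0 ltxx.
by have := probability_setT P; rewrite -AT PA0 => /eqP; rewrite eq_sym onee_eq0.
Qed.

End ProbabilityIntegral.

Section TapeExchange.
Local Open Scope ring_scope.
Local Open Scope ereal_scope.
Context (R : realType) (dA dB : measure_display).
Context (WA : measurableType dA) (WB : measurableType dB).
Variables (PA : probability WA R) (PB : probability WB R).

(* The tape fixed in one family of bounds is random in the other: integrating
   both over it gives two disjoint events of the same probability space, each
   of probability above one half. *)
Lemma disjoint_events_not_both_likely (E1 E2 : set (WA * WA * WB)) :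
  measurable E1 -> measurable E2 -> (E1 `&` E2 = set0)%classic ->
  (forall a', (1 / 2)%:E <
     (PA \x PB) [set w | E1 ((a', w.1), w.2)]%classic) ->
  (forall a, (1 / 2)%:E <
     (PA \x PB) [set w | E2 ((w.1, a), w.2)]%classic) -> False.
Proof.
move=> mE1 mE2 E12 likely1 likely2.
pose h E (u : WA * WA) := PB (xsection E u).
have mh E : measurable E -> measurable_fun setT (h E).
  by move=> mE; exact: measurable_fun_xsection.
have h_ge0 E u : 0 <= h E u by exact: measure_ge0.
(* For fixed tapes of both Alices, the sections are disjoint events on Bob's tape. *)
have h12 u : h E1 u + h E2 u <= 1.
  rewrite /h -measureU //; [|exact: measurable_xsection..|].
    by apply: probability_le1; apply: measurableU; exact: measurable_xsection.
  by rewrite -xsectionI E12 xsection0.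
have mint E : measurable E ->
    measurable_fun setT (fun a' => \int[PA]_a h E (a', a)).
  move=> mE; apply: (@measurable_fun_fubini_tonelli_F _ _ _ _ _ PA) => //.
  exact: mh.
have sec1 a' : (PA \x PB) [set w | E1 ((a', w.1), w.2)]%classic =
    \int[PA]_a h E1 (a', a).
  by apply: eq_integral => a _ /=; congr (PB _).
have sec2 a : (PA \x PB) [set w | E2 ((w.1, a), w.2)]%classic =
    \int[PA]_a' h E2 (a', a).
  by apply: eq_integral => a' _ /=; congr (PB _).
have int1 : (1 / 2)%:E < \int[PA]_a' \int[PA]_a h E1 (a', a).
  apply: integral_probability_gt => [| |a']; first by rewrite divr_ge0.
    exact: mint.
  by rewrite -sec1.
have int2 : (1 / 2)%:E < \int[PA]_a' \int[PA]_a h E2 (a', a).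
  (* The bound on [E2] fixes the second tape, so that tape must become the outer variable. *)
  rewrite (fubini_tonelli _ (mh E2 mE2) (h_ge0 E2)).
  apply: integral_probability_gt => [| |a]; first by rewrite divr_ge0.
    by apply: (@measurable_fun_fubini_tonelli_G _ _ _ _ _ PA) => //; exact: mh.
  by rewrite -sec2.
have : (1 / 2)%:E + (1 / 2)%:E <
    \int[PA]_a' \int[PA]_a h E1 (a', a) + \int[PA]_a' \int[PA]_a h E2 (a', a).
  exact: (lteD int1 int2).
have mslice E a' : measurable E -> measurable_fun setT (fun a => h E (a', a)).
  by move=> mE; apply: measurable_fun_pair2; exact: mh.
rewrite -EFinD -splitr -ge0_integralD //; last first.
- exact: mint.
- by move=> a' _; exact: integral_ge0.
- exact: mint.
- by move=> a' _; exact: integral_ge0.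
apply/negP; rewrite -leNgt.
have le_int1 (g : WA -> \bar R) : measurable_fun setT g ->
    (forall x, 0 <= g x) -> (forall x, g x <= 1) -> \int[PA]_x g x <= 1.
  move=> mg g0 g1; have -> : 1 = \int[PA]_x cst 1 x.
    by rewrite integral_cst //= probability_setT mule1.
  by apply: ge0_le_integral => //; exact: measurable_cst.
apply: (le_int1 _) => [|a'|a'].
- by apply: emeasurable_funD; exact: mint.
- by apply: adde_ge0; exact: integral_ge0.
rewrite -ge0_integralD //; [|exact: mslice..].
apply: le_int1 => // [|a]; first by apply: emeasurable_funD; exact: mslice.
by rewrite adde_ge0.
Qed.

End TapeExchange.


Local Open Scope nat_scope.

(** * The common conversation and the two attacks *)

Section ConfusingConversation.
Variables (S : finType) (K : nat).
Implicit Types (f g : seq S -> S) (l : seq (event S)) (p : party).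

(* The symbols received by Bob and his replies after [n] exchanges, when his
   partner is first an Alice running [f'], and from the [K]-th reply on an Alice
   running [f] that has received nothing before. *)
Fixpoint conversation f' f g n : seq S * seq S :=
  if n is n'.+1 then
    let: (v, u) := conversation f' f g n' in
    let v' := rcons v (if n' < K then f' u else f (drop K.-1 u)) in
    (v', rcons u (g v'))
  else ([::], [::]).

Definition transcript f' f g n := (conversation f' f g n).1.
Definition replies f' f g n := (conversation f' f g n).2.

Lemma transcriptS f' f g n :
  transcript f' f g n.+1 =
  rcons (transcript f' f g n) (if n < K then f' (replies f' f g n)
                               else f (drop K.-1 (replies f' f g n))).
Proof. by rewrite /transcript /replies /=; case: (conversation _ _ _ n). Qed.

Lemma repliesS f' f g n :
  replies f' f g n.+1 =
  rcons (replies f' f g n) (g (transcript f' f g n.+1)).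
Proof. by rewrite /transcript /replies /=; case: (conversation _ _ _ n). Qed.

Lemma size_transcript f' f g n : size (transcript f' f g n) = n.
Proof. by elim: n => // n IHn; rewrite transcriptS size_rcons IHn. Qed.

Lemma size_replies f' f g n : size (replies f' f g n) = n.
Proof. by elim: n => // n IHn; rewrite repliesS size_rcons IHn. Qed.

Definition symbols_of p l : seq S := [seq symbol e | e <- l & sender e == p].

(* Against a real Alice running [f]: her first symbol is replaced by the one of
   a simulated Alice running [f'], who then answers Bob through spoofed
   replies. *)
Definition early_attack f' : adversary S := fun l p s =>
  if size l < K then
    if p == alice then Substitute (f' (symbols_of bob l))
    else Spoof (f' (rcons (symbols_of bob l) s))
  else Deliver.

(* Against a real Alice running [f']: after [K] honest exchanges her symbols are
   replaced by those of a simulated Alice running [f]. *)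
Definition late_attack f : adversary S := fun l p s =>
  if (p == alice) && (2 * K <= size l < 4 * K) then
    Substitute (f (drop K.-1 (symbols_of bob l)))
  else Deliver.

End ConfusingConversation.

Section EventLists.
Variable S : finType.
Implicit Types (e : event S) (l : seq (event S)) (p : party).

Lemma view_rcons p l e :
  view p (rcons l e) =
  if (delivered e).1 == p then rcons (view p l) (delivered e).2 else view p l.
Proof. by rewrite /view filter_rcons; case: ifP => //; rewrite map_rcons. Qed.

Lemma symbols_of_rcons p l e :
  symbols_of p (rcons l e) =
  if sender e == p then rcons (symbols_of p l) (symbol e) else symbols_of p l.
Proof.
by rewrite /symbols_of filter_rcons; case: ifP => //; rewrite map_rcons.
Qed.

Lemma turn_rcons l e : turn (rcons l e) = (delivered e).1.
Proof. by rewrite /turn map_rcons last_rcons. Qed.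

Lemma sent_rcons p l e : sent p (rcons l e) = sent p l + (sender e == p).
Proof. by rewrite /sent -cats1 count_cat /= addn0. Qed.

Lemma corruptions_rcons l e :
  corruptions (rcons l e) = corruptions l + corrupted e.
Proof. by rewrite /corruptions -cats1 count_cat /= addn0. Qed.

End EventLists.

(** * Both attacks realize the common conversation within the budget *)

Section Attacks.
Variables (S : finType) (T : nat) (dA dB : measure_display).
Variables (WA : measurableType dA) (WB : measurableType dB).
Variables (piA : strategy S T WA) (piB : strategy S T WB).
Variables (K : nat) (X Y : {set edge T}) (a : WA) (b : WB).
Implicit Types (adv : adversary S) (l : seq (event S)).

Notation N := (3 * K).
Notation f := (Defs.next piA a X).
Notation g := (Defs.next piB b Y).
Notation stepN adv := (step piA piB N adv X Y a b).
Notation iterate adv n := (iter n (stepN adv) [::]).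

Lemma step_alice adv l (s := f (view alice l)) :
  turn l = alice -> sent alice l < N ->
  stepN adv l = rcons l (Event alice s (adv l alice s)).
Proof. by move=> tl sl; rewrite /step /next_symbol tl eqxx sl. Qed.

Lemma step_bob adv l (s := g (view bob l)) :
  turn l = bob -> sent bob l < N ->
  stepN adv l = rcons l (Event bob s (adv l bob s)).
Proof. by move=> tl sl; rewrite /step /next_symbol tl /= sl. Qed.

Lemma view_step p adv l : exists t, view p (stepN adv l) = view p l ++ t.
Proof.
rewrite /step; case: ifP => _; last by exists [::]; rewrite cats0.
rewrite view_rcons; case: ifP => _; last by exists [::]; rewrite cats0.
by rewrite -cats1; eexists.
Qed.

Lemma view_iter p adv n l :
  exists t, view p (iter n (stepN adv) l) = view p l ++ t.
Proof.
elim: n => [|n [t IHn]]; first by exists [::]; rewrite cats0.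
have [t' Ht'] := view_step p adv (iter n (stepN adv) l).
by exists (t ++ t'); rewrite iterS Ht' IHn catA.
Qed.

Lemma corruptions_iter_late adv n m l :
  (forall l' p s, m <= size l' -> adv l' p s = Deliver) -> m <= size l ->
  corruptions (iter n (stepN adv) l) = corruptions l.
Proof.
move=> advE ml.
suff [] : m <= size (iter n (stepN adv) l) /\
  corruptions (iter n (stepN adv) l) = corruptions l by [].
elim: n => //= n; move: (iter _ _ _) => l' [ml' IHl].
rewrite /step; case: ifP => // _.
by rewrite size_rcons leqW // corruptions_rcons advE // IHl addn0.
Qed.

(** Views only grow, so what Bob has received after [n] steps remains a prefix of his final view,
    from which his output is taken. *)
Lemma take_view_bob adv n v :
  n <= 2 * N -> view bob (iterate adv n) = v ->
  take (size v) (view bob (run piA piB N adv X Y a b)) = v.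
Proof.
move=> nN <-; rewrite /run -(subnK nN) iterD.
have [t ->] := view_iter bob adv (2 * N - n) (iterate adv n).
by rewrite take_size_cat.
Qed.

Section Early.
Variable f' : seq S -> S.
Notation V := (transcript K f' f g).
Notation U := (replies K f' f g).
Notation E n := (iterate (early_attack K f') n).

(** A spoofed reply returns the turn to Bob, so after the first event he alone speaks and Alice
    receives nothing. His replies lag by one behind his receptions, the first of which answers none
    of them. *)
Lemma early_attack_spoofing n : n < K ->
  [/\ turn (E n.+1) = bob, size (E n.+1) = n.+1, view alice (E n.+1) = [::],
      view bob (E n.+1) = V n.+1 & symbols_of bob (E n.+1) = U n]
  /\ (sent alice (E n.+1) = 1 /\ sent bob (E n.+1) = n).
Proof.
elim: n => [K_gt0|n IHn nK].
  rewrite /= step_alice ?muln_gt0 //=.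
  by rewrite /early_attack K_gt0 /= /transcript /= K_gt0.
have {IHn} := IHn (ltnW nK); rewrite [E n.+2]iterS.
move: (E n.+1) => l [[tE sE vaE vbE syE] [saE sbE]].
rewrite [stepN _ l]step_bob ?sbE //; last by lia.
rewrite turn_rcons size_rcons !view_rcons symbols_of_rcons !sent_rcons.
rewrite /early_attack sE nK /= vaE vbE syE saE sbE addn0 addn1.
by rewrite [V n.+2]transcriptS nK repliesS.
Qed.

(** The [K] corruptions swallow Alice's first symbol and Bob's first [K.-1] replies, so his [K]-th
    reply is the first she receives; then everything is delivered. *)
Lemma early_attack_talking j : 0 < K -> j <= K ->
  [/\ turn (E (K + 2 * j)) = bob, size (E (K + 2 * j)) = K + 2 * j,
      view bob (E (K + 2 * j)) = V (K + j)
    & view alice (E (K + 2 * j)) = drop K.-1 (U (K.-1 + j))]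
  /\ (sent alice (E (K + 2 * j)) = j.+1 /\ sent bob (E (K + 2 * j)) = K.-1 + j).
Proof.
move=> K_gt0; elim: j => [_|j IHj jK].
  have Kp : K.-1 < K by rewrite prednK.
  have := early_attack_spoofing Kp; rewrite prednK // !addn0.
  move=> [[-> -> -> -> _] [-> ->]].
  (* Exactly [K.-1] replies exist at this point, so dropping them leaves Alice's empty view. *)
  by rewrite drop_oversize // size_replies.
have -> : K + 2 * j.+1 = (K + 2 * j).+2 by lia.
have {IHj} := IHj (ltnW jK).
rewrite !(iterS (K + 2 * j).+1) !(iterS (K + 2 * j)).
move: (E (K + 2 * j)) => l [[tE sE vbE vaE] [saE sbE]].
rewrite [stepN _ l]step_bob ?sbE //; last by lia.
have advE l' p s : K <= size l' -> early_attack K f' l' p s = Deliver.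
  by rewrite /early_attack ltnNge => ->.
have vU : rcons (drop K.-1 (U (K.-1 + j))) (g (V (K + j))) =
    drop K.-1 (U (K + j)).
  have -> : K + j = (K.-1 + j).+1 by lia.
  by rewrite repliesS drop_rcons // size_replies leq_addr.
rewrite advE ?sE ?leq_addr // vbE.
rewrite step_alice ?sent_rcons ?turn_rcons //=; last by rewrite saE; lia.
rewrite advE ?size_rcons ?sE; last by lia.
rewrite !view_rcons /= saE sbE vaE vbE vU.
rewrite [K + j.+1]addnS transcriptS ltnNge leq_addr /=.
have -> : K.-1 + j.+1 = K + j by lia.
by do 2!split => //; lia.
Qed.

Lemma early_attack_view_bob :
  take (2 * K) (view bob (run piA piB N (early_attack K f') X Y a b)) =
  V (2 * K).
Proof.
have [->|K_gt0] := posnP K; first by rewrite take0.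
have [[_ _ vbE _] _] := early_attack_talking K_gt0 (leqnn K).
rewrite addnn -mul2n in vbE.
have := take_view_bob _ vbE; rewrite size_transcript; apply; lia.
Qed.

Lemma corruptions_early_attack :
  corruptions (run piA piB N (early_attack K f') X Y a b) <= K.
Proof.
rewrite /run; set l := iter _ _ _.
(* The stronger bound is inductive: an event adds at most one corruption, and none once [K] events
   have occurred. *)
suff : corruptions l <= minn K (size l) by rewrite leq_min => /andP[].
rewrite /l; elim: (2 * N) => //= n.
move: (iter _ _ _) => l' IHl; rewrite /step; case: ifP => // _.
rewrite corruptions_rcons size_rcons /early_attack; case: ltnP => sl' /=.
  by case: (turn l' == alice) => /=; lia.
by rewrite addn0; lia.
Qed.

End Early.

Section Late.
Variable f1 : seq S -> S.
Notation V := (transcript K f f1 g).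
Notation U := (replies K f f1 g).
Notation L n := (iterate (late_attack K f1) n).

(** A substitution keeps the recipient, so turns alternate as without noise and the real Alice hears
    every reply. Truncated subtraction makes the first [K] exchanges free. *)
Lemma late_attack_talking n : n <= 2 * K ->
  [/\ turn (L (2 * n)) = alice, size (L (2 * n)) = 2 * n,
      view bob (L (2 * n)) = V n, view alice (L (2 * n)) = U n
    & symbols_of bob (L (2 * n)) = U n]
  /\ [/\ sent alice (L (2 * n)) = n, sent bob (L (2 * n)) = n
       & corruptions (L (2 * n)) = n - K].
Proof.
elim: n => [|n IHn nK]; first by rewrite muln0 /= sub0n.
have -> : 2 * n.+1 = (2 * n).+2 by lia.
have {IHn} := IHn (ltnW nK); rewrite !(iterS (2 * n).+1) !(iterS (2 * n)).
move: (L (2 * n)) => l0 [[tL sL vbL vaL syL] [saL sbL cL]].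
rewrite [stepN _ l0]step_alice ?saL //; last by lia.
set s := Defs.next _ _ _ _; set l := rcons _ _.
have vbl : view bob l = V n.+1.
  rewrite /l view_rcons /late_attack sL syL vbL /s vaL transcriptS /=.
  have -> : (2 * K <= 2 * n < 4 * K) = ~~ (n < K) by lia.
  by case: (n < K).
have tl : turn l = bob.
  by rewrite /l turn_rcons /late_attack; case: ifP.
have [val syl] : view alice l = U n /\ symbols_of bob l = U n.
  rewrite /l view_rcons symbols_of_rcons vaL syL /=.
  by rewrite /late_attack; case: (_ && _).
have [sal sbl sl] :
    [/\ sent alice l = n.+1, sent bob l = n & size l = (2 * n).+1].
  by rewrite /l !sent_rcons size_rcons saL sbL sL addn1 addn0.
have cl : corruptions l = n.+1 - K.
  rewrite /l corruptions_rcons cL /late_attack sL /=.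
  by case: ifP => /=; lia.
clearbody l; rewrite step_bob ?sbl //; last by lia.
rewrite turn_rcons size_rcons !view_rcons symbols_of_rcons !sent_rcons.
rewrite corruptions_rcons /late_attack /= vbl val syl sal sbl sl cl.
by rewrite repliesS !addn0 addn1.
Qed.

Lemma late_attack_view_bob :
  take (2 * K) (view bob (run piA piB N (late_attack K f1) X Y a b)) =
  V (2 * K).
Proof.
have [[_ _ vbL _ _] _] := late_attack_talking (leqnn (2 * K)).
have := take_view_bob _ vbL; rewrite size_transcript; apply; lia.
Qed.

Lemma corruptions_late_attack :
  corruptions (run piA piB N (late_attack K f1) X Y a b) = K.
Proof.
have [[_ sL _ _ _] [_ _ cL]] := late_attack_talking (leqnn (2 * K)).
(* The attack window closes after [4 * K] events; the remaining [2 * K] steps add no corruption. *)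
have -> : run piA piB N (late_attack K f1) X Y a b =
    iter (2 * K) (stepN (late_attack K f1)) (L (2 * (2 * K))).
  by rewrite /run -iterD; congr iter; lia.
have advE l p s : 4 * K <= size l -> late_attack K f1 l p s = Deliver.
  by move=> Kl; rewrite /late_attack [size l < _]ltnNge Kl !andbF.
by rewrite (corruptions_iter_late _ advE) ?cL ?sL; lia.
Qed.

End Late.
End Attacks.

(** * Measurability of conversations and executions *)

Section CountableEvents.
Variable S : finType.

(** Makes executions countable, so that [fiber_measurable_bind] can condition on them. *)
Definition encode_event (e : event S) : party * S * option (bool * S) :=
  (sender e, symbol e,
   match act e with
   | Deliver => None
   | Substitute s => Some (true, s)
   | Spoof s => Some (false, s)
   end).

Definition decode_event (c : party * S * option (bool * S)) : event S :=
  Event c.1.1 c.1.2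
    (if c.2 is Some (b, s) then if b then Substitute s else Spoof s
     else Deliver).

Lemma encode_eventK : cancel encode_event decode_event.
Proof. by case=> p s []. Qed.

HB.instance Definition _ := Countable.copy (event S) (can_type encode_eventK).

End CountableEvents.

Lemma fiber_measurable_conversation (S : finType) (K : nat)
    (d : measure_display) (W : measurableType d) (f' f g : W -> seq S -> S)
    (n : nat) :
  (forall h, fiber_measurable (f'^~ h)) ->
  (forall h, fiber_measurable (f^~ h)) ->
  (forall h, fiber_measurable (g^~ h)) ->
  fiber_measurable (fun w => conversation K (f' w) (f w) (g w) n).
Proof.
move=> mf' mf mg; elim: n => [|n IHn] /=; first exact: fiber_measurable_cst.
pose next_exchange vu w s := let v := rcons vu.1 s in (v, rcons vu.2 (g w v)).
pose alice_symbol u w :=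
  if n < K then f' w u else f w (drop K.-1 u).
have mnext vu : fiber_measurable
    (fun w => next_exchange vu w (alice_symbol vu.2 w)).
  apply: (@fiber_measurable_bind _ _ S _ (alice_symbol vu.2)
    (fun s w => next_exchange vu w s)) => [|s].
    by rewrite /alice_symbol; case: (n < K).
  exact: (@fiber_measurable_comp _ _ S _
    (fun x => (rcons vu.1 s, rcons vu.2 x)) _ (mg (rcons vu.1 s))).
have := @fiber_measurable_bind _ _ (seq S * seq S)%type _ _
  (fun vu w => next_exchange vu w (alice_symbol vu.2 w)) IHn mnext.
by congr fiber_measurable; apply/funext => w; case: conversation.
Qed.

Section MeasurableRun.
Variables (S : finType) (T : nat) (dA dB : measure_display).
Variables (WA : measurableType dA) (WB : measurableType dB).
Variables (piA : strategy S T WA) (piB : strategy S T WB).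
Variables (N : nat) (adv : adversary S) (X Y : {set edge T}).
Implicit Type l : seq (event S).

Lemma fiber_measurable_next_symbol l :
  fiber_measurable
    (fun w : WA * WB => next_symbol piA piB X Y w.1 w.2 l).
Proof.
rewrite /next_symbol; case: (turn l == alice).
  exact: (fiber_measurable_precomp measurable_fst
    (@measurable_next _ _ _ _ piA X (view alice l))).
exact: (fiber_measurable_precomp measurable_snd
  (@measurable_next _ _ _ _ piB Y (view bob l))).
Qed.

Lemma fiber_measurable_run :
  fiber_measurable (fun w : WA * WB => run piA piB N adv X Y w.1 w.2).
Proof.
rewrite /run; elim: (2 * N) => [|n IHn] /=.
  exact: fiber_measurable_cst.
apply: (@fiber_measurable_bind _ _ (seq (event S)) _ _
  (fun l w => step piA piB N adv X Y w.1 w.2 l) IHn) => l.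
apply: (@fiber_measurable_comp _ _ S _
  (fun s => let p := turn l in
    if sent p l < N then rcons l (Event p s (adv l p s)) else l)).
exact: fiber_measurable_next_symbol.
Qed.

Lemma measurable_both_correct m :
  measurable
    [set w : WA * WB | both_correct piA piB N adv X Y m w.1 w.2]%classic.
Proof.
pose correct d (W : measurableType d) (pi : strategy S T W) Z h (w : W) :=
  oapp (is_pjp_path X Y) false
    (if m <= size h then Some (output pi w Z (take m h)) else None).
have mcorrect d (W : measurableType d) (pi : strategy S T W) Z h :
    fiber_measurable (correct d W pi Z h).
  rewrite /correct; case: (m <= size h) => /=; last exact: fiber_measurable_cst.
  apply: (@fiber_measurable_comp _ _ (T.-tuple bool)).
  exact: measurable_output.
suff : fiber_measurable (fun w : WA * WB =>
    both_correct piA piB N adv X Y m w.1 w.2) by exact.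
(* Once the execution is fixed, the correctness of each output depends on that party's own tape
   only. *)
apply: (@fiber_measurable_bind _ _ (seq (event S)) _ _
  (fun l w => correct _ _ piA X (view alice l) w.1 &&
              correct _ _ piB Y (view bob l) w.2) fiber_measurable_run) => l.
apply: (@fiber_measurable_bind _ _ bool _ _
  (fun c w => c && correct _ _ piB Y (view bob l) w.2)).
  exact: (fiber_measurable_precomp measurable_fst (mcorrect _ _ piA X _)).
move=> c; apply: (@fiber_measurable_comp _ _ bool _ (andb c)).
exact: (fiber_measurable_precomp measurable_snd (mcorrect _ _ piB Y _)).
Qed.

End MeasurableRun.

(** * Inputs that differ at the root, and the final contradiction *)

Section Inputs.
Variable T : nat.

Definition constant_input (par c : bool) : {set edge T} :=
  [set e : edge T | [&& size e.1 < T, odd (size e.1) == par & e.2 == c]].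

Lemma constant_inputP par c : is_input par (constant_input par c).
Proof.
apply/forallP => v.
case: (boolP ((size v < T) && (odd (size v) == par))) => [vP|nvP].
  rewrite (_ : [set e in constant_input par c | e.1 == v] = [set (v, c)]).
    by rewrite cards1.
  apply/setP => -[u x]; rewrite !inE /= xpair_eqE.
  by case: (eqVneq u v) => [->|] /=; rewrite ?andbF // andbT andbA vP.
rewrite (_ : [set e in constant_input par c | e.1 == v] = finset.set0).
  by rewrite cards0.
apply/setP => -[u x]; rewrite !inE /=.
by case: (eqVneq u v) => [->|] /=; rewrite ?andbF // andbT andbA (negbTE nvP).
Qed.

(** The root has even depth, so only Alice's edge leaves it. *)
Lemma pjp_path_root (T_gt0 : 0 < T) (c c' : bool) (p : T.-tuple bool) :
  is_pjp_path (constant_input false c) (constant_input true c') p ->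
  tnth p (Ordinal T_gt0) = c.
Proof.
move=> /forallP /(_ (Ordinal T_gt0)).
by rewrite !inE /= take0 /= andbF orbF => /andP[_ /eqP].
Qed.

End Inputs.

Local Open Scope ring_scope.

Lemma rate_one_sixth_horizon (R : realType) (N m : nat) (rho : R) :
  rho = 1 / 6 -> m%:R = (1 - 2 * rho) * N%:R ->
  exists2 K, N = (3 * K)%N & m = (2 * K)%N.
Proof.
move=> -> mE.
have : (3 * m = 2 * N)%N.
  by apply/eqP; rewrite -(eqr_nat R) !natrM mE; apply/eqP; lra.
(* From [3 * m = 2 * N], [m] is even and half of it is a third of [N]. *)
by move=> mN; exists (m %/ 2)%N; lia.
Qed.


Theorem theorem10 (R : realType) (S : finType) (T N m : nat) (rho : R)
    (dA dB : measure_display)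
    (WA : measurableType dA) (WB : measurableType dB)
    (PA : probability WA R) (PB : probability WB R)
    (piA : strategy S T WA) (piB : strategy S T WB)
    (T_gt0 : (0 < T)%N)
    (rhoE : rho = 1 / 6)
    (mE : m%:R = (1 - 2 * rho) * N%:R) :
  ~ (forall (X Y : {set edge T}) (adv : adversary S),
       alice_input X -> bob_input Y ->
       (forall (a : WA) (b : WB),
          (corruptions (run piA piB N adv X Y a b))%:R <= 2 * rho * N%:R) ->
       ((1 / 2)%:E <
          (PA \x PB)%E [set w | both_correct piA piB N adv X Y m w.1 w.2]%classic)%E).
Proof.
move=> likely.
have [K NE mKE] := rate_one_sixth_horizon rhoE mE; subst N m.
pose X c := constant_input T false c; pose Y := constant_input T true false.
have XP c : alice_input (X c) by exact: constant_inputP.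
have YP : bob_input Y by exact: constant_inputP.
have budget k : (k <= K)%N -> k%:R <= 2 * rho * (3 * K)%:R :> R.
  by rewrite rhoE natrM -(ler_nat R) => ?; lra.
pose f c (a : WA) := Defs.next piA a (X c).
(* The first tape belongs to the Alice on [X true], who opens the conversation, the second to the
   one on [X false], who takes over. *)
pose guess (u : WA * WA * WB) := output piB u.2 Y
  (transcript K (f true u.1.1) (f false u.1.2) (Defs.next piB u.2 Y) (2 * K)).
pose success c := [set u | is_pjp_path (X c) Y (guess u)]%classic.
have m11 : measurable_fun setT (fun u : WA * WA * WB => u.1.1).
  exact: (measurableT_comp measurable_fst measurable_fst).
have m12 : measurable_fun setT (fun u : WA * WA * WB => u.1.2).
  exact: (measurableT_comp measurable_snd measurable_fst).
have mguess : fiber_measurable guess.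
  have mnext c h := @measurable_next _ _ _ _ piA (X c) h.
  have mtranscript := @fiber_measurable_comp _ _ (seq S * seq S)%type _
    (fun vu => vu.1) _ (@fiber_measurable_conversation S K _ _
      (fun u : WA * WA * WB => f true u.1.1) (fun u => f false u.1.2)
      (fun u => Defs.next piB u.2 Y) (2 * K)
      (fun h => fiber_measurable_precomp m11 (mnext true h))
      (fun h => fiber_measurable_precomp m12 (mnext false h))
      (fun h => fiber_measurable_precomp measurable_snd
        (@measurable_next _ _ _ _ piB Y h))).
  apply: (@fiber_measurable_bind _ _ (seq S) _ _
    (fun h u => output piB u.2 Y h) mtranscript) => h.
  exact: (fiber_measurable_precomp measurable_snd
    (@measurable_output _ _ _ _ piB Y h)).
have msuccess c : measurable (success c).
  exact: (@fiber_measurable_comp _ _ (T.-tuple bool) _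
    (is_pjp_path (X c) Y) _ mguess true).
have mslice c (h : WA * WB -> WA * WA * WB) :
    measurable_fun setT h -> measurable [set w | success c (h w)]%classic.
  by move=> mh; have := mh measurableT _ (msuccess c); rewrite setTI.
apply: (disjoint_events_not_both_likely (PA := PA) (PB := PB)
  (msuccess false) (msuccess true)).
(* A single guess cannot leave the root in both directions. *)
- apply/seteqP; split=> // u [/=].
  move=> /(pjp_path_root T_gt0) + /(pjp_path_root T_gt0).
  by move=> ->.
- move=> a'.
  (* The fixed tape [a'] is hard-wired into the adversary; the real Alice runs on [X false]. *)
  have attack a b : (corruptions (run piA piB (3 * K) (early_attack K (f true a'))
      (X false) Y a b))%:R <= 2 * rho * (3 * K)%:R.
    by apply: budget; exact: corruptions_early_attack.
  apply: (lt_le_trans (likely _ _ _ (XP false) YP attack)).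
  apply: le_measure; rewrite ?inE; first exact: measurable_both_correct.
    exact: (mslice _ _ (measurable_fun_pair
      (measurable_fun_pair (measurable_cst _) measurable_fst) measurable_snd)).
  move=> w /= /andP[_]; rewrite /output_bob; case: ifP => // _ /=.
  by rewrite early_attack_view_bob.
- move=> a.
  (* Here the tape on [X false] is hard-wired and the real Alice runs on [X true]. *)
  have attack a' b : (corruptions (run piA piB (3 * K) (late_attack K (f false a))
      (X true) Y a' b))%:R <= 2 * rho * (3 * K)%:R.
    by apply: budget; rewrite corruptions_late_attack.
  apply: (lt_le_trans (likely _ _ _ (XP true) YP attack)).
  apply: le_measure; rewrite ?inE; first exact: measurable_both_correct.
    exact: (mslice _ _ (measurable_fun_pair
      (measurable_fun_pair measurable_fst (measurable_cst _)) measurable_snd)).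
  move=> w /= /andP[_]; rewrite /output_bob; case: ifP => // _ /=.
  by rewrite late_attack_view_bob.
Qed.
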